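(* Let $\mathbf{X}_n$, $n\in\mathbb{Z}_+$, be a subcritical $p$-type Galton--Watson process (with immigration, as defined in the context) such that $E\|\boldsymbol{\eta}(1)\|^\alpha<\infty$ for some $\alpha>0$, and let $\pi$ denote its stationary distribution (which exists and is unique under these hypotheses). Then there exists a finite constant $a_1>1$ such that $$\sum_{n=0}^\infty a_1^n\sup_{B\subseteq\mathbb{Z}_+^p}\big|P_{\mathbf{x}}(\mathbf{X}_n\in B)-\pi(B)\big|<\infty\qquad\text{for every }\mathbf{x}\in\mathbb{Z}_+^p,$$ that is, the process is geometrically ergodic.
   Context: $\mathbb{Z}_+$ is the set of nonnegative integers and $p$ is a positive integer. A $p$-type Galton--Watson process $\mathbf{X}_n=(X_{n,1},\dots,X_{n,p})^\top$, $n\in\mathbb{Z}_+$, is a $\mathbb{Z}_+^p$-valued Markov chain defined by the recursion $$\mathbf{X}_n=\sum_{i=1}^p\sum_{k=1}^{X_{n-1,i}}\boldsymbol{\xi}_i(n,k)+\boldsymbol{\eta}(n),\qquad n=1,2,\dots,$$ where the $\mathbb{Z}_+^p$-valued random vectors $\mathbf{X}_0$, $\boldsymbol{\xi}_i(n,k)$, $\boldsymbol{\eta}(n)$ ($i=1,\dots,p$; $n,k=1,2,\dots$) are independent of each other; for each $i$ the offspring variables $\boldsymbol{\xi}_i(n,k)$, $n,k\ge1$, are identically distributed; and the innovation variables $\boldsymbol{\eta}(n)$, $n\ge1$, are identically distributed. (The components of a single offspring or innovation vector may be dependent.) Standing assumption: all offspring variables have finite expectation. The mean matrix is $\mathbf{M}=[E\boldsymbol{\xi}_1(1,1),\dots,E\boldsymbol{\xi}_p(1,1)]^\top$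 (so $M_{i,j}$ is the expectation of the $j$-th component of $\boldsymbol{\xi}_i(1,1)$), $\varrho(\mathbf{M})$ is its spectral radius, and the process is called subcritical if $\varrho(\mathbf{M})<1$. For $\mathbf{x}\in\mathbb{R}^p$, $\|\mathbf{x}\|=|x_1|+\cdots+|x_p|$. $P_{\mathbf{x}}$ denotes probability conditional on $\{\mathbf{X}_0=\mathbf{x}\}$ (i.e. for the chain started at $\mathbf{x}$). A stationary distribution is a probability measure on $\mathbb{Z}_+^p$ invariant for the Markov chain. *)

(* Defs.v *)
From HB Require Import structures.
From mathcomp Require Import all_boot all_order all_algebra complex.
From mathcomp Require Import all_classical all_reals all_analysis.

Set Implicit Arguments.
Unset Strict Implicit.
Unset Printing Implicit Defensive.
Import Order.TTheory GRing.Theory Num.Theory.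
Import numFieldNormedType.Exports.
Local Open Scope classical_set_scope.
Local Open Scope ring_scope.

(* Z_+^p.  The alias carries the discrete sigma-algebra: every subset of
   [zvec p] is an event. *)
Definition zvec (p : nat) := 'rV[nat]_p.

HB.instance Definition _ (p : nat) := GRing.Nmodule.on (zvec p).
HB.instance Definition _ (p : nat) := isPointed.Build (zvec p) (0 : 'rV[nat]_p).
HB.instance Definition _ (p : nat) := @isMeasurable.Build
  default_measure_display (zvec p) discrete_measurable
  discrete_measurable0 discrete_measurableC discrete_measurableU.

(* The entries are nonnegative, so no absolute values are needed. *)
Definition l1norm (R : realType) (p : nat) (x : zvec p) : R :=
  \sum_(j < p) (x ord0 j)%:R.

(* The norm of R[i] is R[i]-valued; [complex.Re] reads it back in R. *)
Definition spectral_radius (R : realType) (p : nat) (M : 'M[R]_p) : R :=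
  sup [set complex.Re `|z| |
       z in [set z : R[i] |
              eigenvalue (map_mx (real_complex R) M) z]].

Section GaltonWatson.
Context (R : realType) (p : nat) (d : measure_display) (W : measurableType d).
Context (P : probability W R).

Definition mutually_independent (J : eqType) (Y : J -> {RV P >-> zvec p}) :=
  forall (s : seq J) (B : J -> set (zvec p)), uniq s ->
    P (\bigcap_(j in [set` s]) Y j @^-1` B j) =
    (\prod_(j <- s) P (Y j @^-1` B j))%E.

(* Time and particle indices are shifted to start at 0: [xi i n k] is the
   vector xi_i(n+1,k+1) and [eta n] is eta(n+1). *)
Context (xi : 'I_p -> nat -> nat -> {RV P >-> zvec p}).
Context (eta : nat -> {RV P >-> zvec p}).

Definition gw_step (n : nat) (x : zvec p) (w : W) : zvec p :=
  (\sum_(i < p) \sum_(k < x ord0 i) xi i n k w) + eta n w.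

(* The single family gathering X_0, all the offspring and all the innovation
   vectors. *)
Definition gw_family (X0 : {RV P >-> zvec p})
    (j : unit + ('I_p * nat * nat) + nat) : {RV P >-> zvec p} :=
  match j with
  | inl (inl _) => X0
  | inl (inr (i, n, k)) => xi i n k
  | inr n => eta n
  end.

Record gw_process (X : nat -> {RV P >-> zvec p}) : Prop := {
  gw_indep : mutually_independent (gw_family (X 0%N));
  gw_offspring_id : forall i n k B,
    distribution P (xi i n k) B = distribution P (xi i 0%N 0%N) B;
  gw_innovation_id : forall n B,
    distribution P (eta n) B = distribution P (eta 0%N) B;
  gw_rec : forall n w, X n.+1 w = gw_step n (X n w) w
}.

(* For each i, the xi_i(n,k) have the law of xi_i(1,1), here [xi i 0 0]. *)
Definition offspring_integrable : Prop :=
  forall (i j : 'I_p),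
    P.-integrable setT (fun w => ((xi i 0%N 0%N w ord0 j)%:R : R)%:E).

Definition mean_matrix : 'M[R]_p :=
  \matrix_(i < p, j < p) fine ('E_P[fun w => ((xi i 0%N 0%N w ord0 j)%:R : R)])%E.

Fixpoint gw_from (x : zvec p) (n : nat) (w : W) : zvec p :=
  if n is m.+1 then gw_step m (gw_from x m w) w else x.

(* P_x(X_n \in B), defined through the chain started at x and driven by the
   same offspring and innovation vectors: it makes sense for every x, whatever
   the law of X_0, and since X_0 is independent of [xi] and [eta] it is the
   conditional probability given X_0 = x whenever the latter event has
   positive probability. *)
Definition gw_prob (x : zvec p) (n : nat) (B : set (zvec p)) : \bar R :=
  P [set w | B (gw_from x n w)].

Definition stationary (pi : probability (zvec p) R) : Prop :=
  forall B : set (zvec p), (pi B = \int[pi]_x gw_prob x 1%N B)%E.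

End GaltonWatson.

(* Main.v *)
Require Import Defs.
From HB Require Import structures.
From mathcomp Require Import all_boot all_order all_algebra complex.
From mathcomp Require Import all_classical all_reals all_analysis.
From mathcomp Require Import measurable_realfun lra.

(* Only the contraction of the transition kernel matters.  Perron-Frobenius
   gives rho < 1 and a vector v >= 1 with M v <= rho v.  Call f : Z_+^p -> R
   K-Lipschitz if moving one step in direction i changes f by at most K v_i.
   Adding an individual of type i to x adds one independent copy of xi_i to the
   next generation, so the kernel maps K-Lipschitz functions to
   (rho K)-Lipschitz ones; as indicator functions are 1-Lipschitz,
   |P_x(X_n in B) - P_0(X_n in B)| <= rho^n v.x uniformly in B.  The left-hand
   side is also at most 1, hence at most r^n (v.x)^b for b = min(alpha, 1) and
   r = rho^b.  Conditioning on the first step, |P_0(X_{n+1} in B) -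
   P_0(X_n in B)| <= r^n E (v.eta)^b, so that P_0(X_n in .) converges
   geometrically fast, uniformly in B, to a probability measure pi, which is
   the stationary distribution. *)

Set Implicit Arguments.
Unset Strict Implicit.
Unset Printing Implicit Defensive.
Import Order.TTheory GRing.Theory Num.Theory.
Import numFieldNormedType.Exports.
Local Open Scope classical_set_scope.
Local Open Scope ring_scope.

(** * A weight vector for a nonnegative matrix *)

(** [sup] is an upper bound only for a set that is bounded above. Here the characteristic polynomial
    splits over [R[i]], and the sum of the moduli of its roots is a bound. *)
Lemma eigenvalue_norm_le_spectral_radius (R : realType) (p : nat) (M : 'M[R]_p)
    (t : R) : eigenvalue M t -> `|t| <= spectral_radius M.
Proof.
move=> Mt; apply: ub_le_sup; last first.
  exists (real_complex R t); first by rewrite /= eigenvalue_map.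
  by rewrite /= expr0n addr0 sqrtr_sqr.
have [rs Mrs] := closed_field_poly_normal (char_poly (map_mx (real_complex R) M)).
exists (\sum_(z <- rs) complex.Re `|z|) => _ [z /= Mz <-].
have zrs : z \in rs.
  move: Mz; rewrite eigenvalue_root_char Mrs rootZ ?root_prod_XsubC//.
  by rewrite (monicP (char_poly_monic _)) oner_eq0.
have Re0 (w : R[i]) : 0 <= complex.Re `|w|.
  by have := normr_ge0 w; rewrite lecE => /andP[].
rewrite (perm_big _ (perm_to_rem zrs)) big_cons /= lerDl.
by apply: sumr_ge0 => w _; exact: Re0.
Qed.

Section perron_weight.
Context (R : realType) (p : nat) (M : 'M[R]_p).

Let chi (t : R) := (char_poly M).[t].

(* The [i]-th entry of [(t - M)^-1 1]. *)
Let u (t : R) (i : 'I_p) :=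
  (\sum_j ((\adj (char_poly_mx M)) i j).[t]) / chi t.

(** Row [i] of [(t - M) adj(t - M) = chi(t) I], summed over the columns and divided by [chi t]. *)
Let u_eq t i : chi t != 0 -> t * u t i = 1 + \sum_j M i j * u t j.
Proof.
move=> chi0.
have E j : \sum_k ((t *+ (i == k)) - M i k) * ((\adj (char_poly_mx M)) k j).[t]
           = chi t *+ (i == j).
  have := congr1 (fun A : 'M[{poly R}]_p => (A i j).[t])
    (mul_mx_adj (char_poly_mx M)).
  rewrite !mxE hornerMn => <-; rewrite horner_sum; apply: eq_bigr => k _.
  by rewrite hornerM !mxE !hornerE hornerMn hornerX.
have : \sum_j \sum_k ((t *+ (i == k)) - M i k) * ((\adj (char_poly_mx M)) k j).[t]
       = chi t.
  rewrite (eq_bigr _ (fun j _ => E j)) (bigD1 i)//= eqxx big1 ?addr0// => j ji.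
  by rewrite eq_sym (negbTE ji).
rewrite exchange_big /= => /(congr1 (fun x => x / chi t)).
rewrite divff// mulr_suml => <-.
under [X in _ = X + _]eq_bigr do rewrite -mulr_sumr -mulrA -/(u t _) mulrBl.
rewrite -big_split /=; under eq_bigr do rewrite subrK.
rewrite (bigD1 i)//= eqxx mulr1n big1 ?addr0// => j ji.
by rewrite eq_sym (negbTE ji) mulr0n mul0r.
Qed.

Let u_continuous i t : chi t != 0 -> {for t, continuous (fun t => u t i)}.
Proof.
move=> chi0; apply: cvgM; last first.
  by apply: cvgV => //; exact: continuous_horner.
rewrite (_ : (fun _ => _) =
   horner (\sum_j ((\adj (char_poly_mx M)) i j))); last first.
  by apply/funext => s; rewrite horner_sum.
rewrite -horner_sum; exact: continuous_horner.
Qed.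

(** The default [1] caps the minimum without affecting its sign, and only the sign matters below. *)
Let m t := \big[Num.min/1]_i u t i.

Let m_continuous t : chi t != 0 -> {for t, continuous m}.
Proof.
move=> chi0; rewrite /m; elim: (index_enum _) => [|i s ih].
  rewrite (_ : (fun _ => _) = cst 1); first exact: cst_continuous.
  by apply/funext => x; rewrite big_nil.
rewrite (_ : (fun _ => _) =
    (fun x => u x i) \min (fun x => \big[Num.min/1]_(i <- s) u x i)); last first.
  by apply/funext => x; rewrite big_cons.
by apply: continuous_min => //; exact: u_continuous.
Qed.

Hypothesis M_ge0 : forall i j, 0 <= M i j.
Hypothesis M_lt1 : spectral_radius M < 1.

(* As [t] decreases from infinity, [min_i u t i] cannot cross [0]: where all
   the entries of [u t] are nonnegative, [t u = 1 + M u] bounds them below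
   by [1 / t]. *)
Lemma perron_weight : exists rho : R, exists v : 'I_p -> R,
  [/\ 0 < rho < 1, forall i, 1 <= v i
    & forall i, \sum_j M i j * v j <= rho * v i].
Proof.
(* The maximum with [0] gives [s >= 0], so that the midpoint [rho] of [s] and [1] is positive, less
   than [1] and beyond every real eigenvalue. *)
pose s := Num.max 0 (spectral_radius M).
have s1 : s < 1 by rewrite gt_max ltr01.
have s0 : 0 <= s by rewrite le_max lexx.
pose rho := (s + 1) / 2.
have rho0 : 0 < rho by rewrite /rho; lra.
have rho1 : rho < 1 by rewrite /rho; lra.
have srho : s < rho by rewrite /rho; lra.
have chi_neq0 t : rho <= t -> chi t != 0.
  move=> rt; apply/negP => /eqP chi0.
  have : eigenvalue M t by rewrite eigenvalue_root_char /root -/(chi t) chi0.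
  move/eigenvalue_norm_le_spectral_radius.
  have t0 : 0 <= t by lra.
  rewrite ger0_norm// => tM.
  have : spectral_radius M <= s by rewrite le_max lexx orbT.
  lra.
have u_ge0 t : rho <= t -> 0 <= m t -> forall i, t^-1 <= u t i.
  move=> rt /bigmin_geP[_ ut] i.
  have t0 : 0 < t by lra.
  rewrite -(ler_pM2l t0) mulfV ?gt_eqF// u_eq ?chi_neq0// lerDl.
  by apply: sumr_ge0 => j _; rewrite mulr_ge0// ut.
(* [T] exceeds every row sum of [M] by at least [1]. If the least entry [u T k] were negative, then
   [T * u T k >= 1 + (T - 1) * u T k], that is, [u T k >= 1]. *)
pose T := 1 + \sum_i \sum_j M i j.
have T1 : 1 <= T by rewrite lerDl; do 2 (apply: sumr_ge0 => ? _).
have rT : rho <= T by lra.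
have mT : 0 <= m T.
  apply/bigmin_geP; split => // i _; rewrite leNgt; apply/negP => ui0.
  pose k := [arg min_(j < i) u T j]%O.
  have uk j : u T k <= u T j by rewrite /k; case: arg_minP => // k' _; apply.
  have uk0 : u T k < 0 by apply: le_lt_trans ui0.
  have := u_eq k (chi_neq0 _ rT).
  have : \sum_j M k j * u T k <= \sum_j M k j * u T j.
    by apply: ler_sum => j _; exact: ler_wpM2l.
  have : \sum_j M k j <= T - 1.
    rewrite /T addrAC subrr add0r [leRHS](bigD1 k)//= lerDl.
    by do 2 (apply: sumr_ge0 => ? _).
  rewrite -mulr_suml => /(ler_wnM2r (ltW uk0)); nra.
have mrho : 0 <= m rho.
  rewrite leNgt; apply/negP => mrho0.
  have [] := @IVT R m rho T 0 rT.
  - apply: continuous_in_subspaceT => t; rewrite inE /= in_itv /= => /andP[rt _].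
    exact: m_continuous (chi_neq0 _ rt).
  - by rewrite ge_min le_max mT (ltW mrho0) orbT.
  move=> t; rewrite in_itv /= => /andP[rt _] mt0.
  have t0 : 0 < t by lra.
  have ut := u_ge0 t rt (eq_ind_r (fun x => 0 <= x) (lexx _) mt0).
  suff : 0 < m t by rewrite mt0 ltxx.
  by apply/bigmin_gtP; split => // i _; apply: lt_le_trans (ut i); rewrite invr_gt0.
(* Entrywise [u rho >= 1 / rho >= 1], and [M u = rho u - 1 <= rho u]. *)
exists rho, (u rho); split=> [|i|i]; first by rewrite rho0.
  apply: le_trans (u_ge0 _ (lexx _) mrho i).
  by rewrite invf_ge1// ltW.
by rewrite u_eq ?chi_neq0// lerDr.
Qed.

End perron_weight.

(** * Independence in a countable state space *)

Section zvec_code.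
Context (p : nat).

(** States are numbered so that a case distinction on a random state is a union indexed by [nat].
    The default value in [zdecode] is harmless: no state has such a code, so the corresponding event
    is empty. *)
Definition zcode (x : zvec p) : nat := pickle (x : 'rV[nat]_p).
Definition zdecode (k : nat) : zvec p := odflt (0 : 'rV[nat]_p) (unpickle k).

Lemma zcodeK : cancel zcode zdecode.
Proof. by move=> x; rewrite /zdecode /zcode pickleK. Qed.

Lemma measurable_fun_zvec d (T : measurableType d) (f : zvec p -> T) :
  measurable_fun [set: zvec p] f.
Proof. by []. Qed.

End zvec_code.

Section zcode_partition.
Context (p : nat) (W : Type) (f : W -> zvec p).

Definition level (k : nat) : set W := [set w | zcode (f w) = k].

Lemma levelE k w : level k w -> f w = zdecode p k.
Proof. by move=> <-; rewrite zcodeK. Qed.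

Lemma trivIset_levelI (F : nat -> set W) :
  (forall k, F k `<=` level k) -> trivIset setT F.
Proof. by move=> Fl i j _ _ [w [/Fl <- /Fl <-]]. Qed.

Lemma bigcup_levelI (E : set W) : E = \bigcup_k (E `&` level k).
Proof.
by apply/seteqP; split=> [w Ew|w [k _ []]//]; exists (zcode (f w)).
Qed.

End zcode_partition.

(** On each piece of the countable partition by the value of [f], the index of [U] is constant. *)
Lemma measurable_fun_select d (W : measurableType d) (p q : nat)
    (f : W -> zvec p) (U : zvec p -> W -> zvec q) :
  measurable_fun [set: W] f -> (forall x, measurable_fun [set: W] (U x)) ->
  measurable_fun [set: W] (fun w => U (f w) w).
Proof.
move=> mf mU _ B _; rewrite setTI (bigcup_levelI f (_ @^-1` B)).
apply: bigcupT_measurable => k.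
rewrite (_ : _ `&` _ =
    (U (zdecode p k) @^-1` B) `&` (f @^-1` [set x | zcode x = k])).
  by apply: measurableI; rewrite -[X in measurable X]setTI; [exact: mU|exact: mf].
by apply/seteqP; split=> w [/= Bw fw]; split=> //; move: Bw; rewrite (levelE fw).
Qed.

Section independence.
Context (R : realType) (p : nat) (d : measure_display) (W : measurableType d).
Context (P : probability W R) (J : eqType) (Y : J -> {RV P >-> zvec p}).

(** Independence of [E] from the subfamily indexed by [A], tested on finite intersections only, so
    that no generated sigma-algebra is needed. *)
Definition indep_of (A : pred J) (E : set W) := measurable E /\
  forall (s : seq J) (B : J -> set (zvec p)), uniq s -> all A s ->
    P (E `&` \bigcap_(j in [set` s]) Y j @^-1` B j) =
    (P E * \prod_(j <- s) P (Y j @^-1` B j))%E.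

Let mY j B : measurable (Y j @^-1` B).
Proof. exact: measurable_funPTI. Qed.

Let mYs (s : seq J) B : measurable (\bigcap_(j in [set` s]) Y j @^-1` B j).
Proof. by apply: fin_bigcap_measurable. Qed.

Lemma indep_of_set0 A : indep_of A set0.
Proof. by split=> // s B _ _; rewrite set0I measure0 mul0e. Qed.

Lemma indep_of_setT A : mutually_independent Y -> indep_of A setT.
Proof.
by move=> indY; split=> // s B us _; rewrite setTI indY// probability_setT mul1e.
Qed.

Lemma sub_indep_of (A A' : pred J) E :
  subpred A' A -> indep_of A E -> indep_of A' E.
Proof.
by move=> AA [mE indE]; split=> // s B us /(sub_all AA); exact: indE.
Qed.

(** Both claims come from the product formula for [E], over [[:: j]] and over [j :: s] with [C] as
    the event at [j]; this uses up the index [j]. *)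
Lemma indep_ofI A E j C : indep_of A E -> A j ->
  indep_of [pred i | A i && (i != j)] (E `&` Y j @^-1` C) /\
  P (E `&` Y j @^-1` C) = (P E * P (Y j @^-1` C))%E.
Proof.
move=> [mE indE] Aj.
have PI : P (E `&` Y j @^-1` C) = (P E * P (Y j @^-1` C))%E.
  have := indE [:: j] (fun=> C) isT; rewrite /= Aj big_seq1 => /(_ isT) <-.
  by rewrite set_cons1 bigcap_set1.
split=> //; split=> [|s B us sA]; first exact: measurableI.
have js : j \notin s.
  by apply/negP => /(allP sA); rewrite /= eqxx andbF.
have sB : (\prod_(i <- s) P (Y i @^-1` (if i == j then C else B i)) =
           \prod_(i <- s) P (Y i @^-1` B i))%E.
  apply: eq_big_seq => i is_; case: eqP => // ij.
  by move: is_; rewrite ij (negbTE js).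
have := indE (j :: s) (fun i => if i == j then C else B i).
rewrite /= js us Aj big_cons eqxx /= => /(_ isT).
rewrite (sub_all _ sA) => [/(_ isT)|i /andP[]//].
have -> : [set` j :: s] = j |` [set` s].
  apply/seteqP; split=> i /=; rewrite in_cons.
    by case/orP => [/eqP|]; [left|right].
  by case=> [->|->]; rewrite ?eqxx ?orbT.
rewrite sB PI muleA => <-; rewrite bigcap_setU1 eqxx setIA.
congr (P (_ `&` _)); apply: eq_bigcapr => i /= is_; case: eqP => // ij.
by move: is_; rewrite ij (negbTE js).
Qed.

Lemma indep_of_bigcup A (F : nat -> set W) : trivIset setT F ->
  (forall k, indep_of A (F k)) -> indep_of A (\bigcup_k F k).
Proof.
move=> tF indF; have mF k : measurable (F k) by case: (indF k).
split=> [|s B us sA]; first exact: bigcupT_measurable.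
rewrite setI_bigcupl measure_semi_bigcup; last 3 first.
- by move=> k; exact: measurableI.
- exact: trivIset_setIr.
- by apply: bigcupT_measurable => k; exact: measurableI.
rewrite measure_semi_bigcup//; last exact: bigcupT_measurable.
have -> : (\prod_(j <- s) P (Y j @^-1` B j) =
           (\prod_(j <- s) fine (P (Y j @^-1` B j)))%:E)%E.
  rewrite -prodEFin; apply: eq_bigr => j _.
  by rewrite fineK ?fin_num_measure.
rewrite muleC -nneseriesZl//; apply: eq_eseriesr => k _.
rewrite [LHS](indF k).2// muleC -prodEFin; congr (_ * _)%E.
by apply: eq_bigr => j _; rewrite fineK ?fin_num_measure.
Qed.

(** The convolution of the listed laws, by conditioning on the first term. It sees the laws alone,
    which is how equality in law of the variables will give time homogeneity. *)
Fixpoint sum_law (mus : seq (set (zvec p) -> \bar R)) (B : set (zvec p)) : \bar R :=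
  if mus is mu :: mus' then
    (\sum_(k <oo) mu (@zcode p @^-1` [set k])
      * sum_law mus' [set z | B (zdecode p k + z)%R])%E
  else (\1_B (0 : zvec p))%:E.

Let law j (B : set (zvec p)) := P (Y j @^-1` B).

Lemma sum_law_ge0 s B : (0 <= sum_law (map law s) B)%E.
Proof.
elim: s B => [|j s ih] B /=; first by rewrite lee_fin.
by apply: nneseries_ge0 => k _ _; rewrite mule_ge0.
Qed.

(** Induction on [s]: splitting [E] by the value of [Y j] gives events independent of the family
    without [j], so [A] and [E] vary along the induction. *)
Lemma indep_of_sum A s E B : uniq s -> all A s -> indep_of A E ->
  indep_of [pred i | A i && (i \notin s)]
    (E `&` [set w | B (\sum_(j <- s) Y j w)]) /\
  P (E `&` [set w | B (\sum_(j <- s) Y j w)]) =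
    (P E * sum_law (map law s) B)%E.
Proof.
elim: s A E B => [|j s ih] A E B /=.
  move=> _ _ indE; under eq_set do rewrite big_nil.
  have [B0|B0] := pselect (B 0).
    rewrite indicE mem_set// mule1 (_ : [set _ | _] = setT) ?setIT; last first.
      by apply/seteqP; split.
    by split=> //; apply: sub_indep_of indE => i /andP[].
  rewrite indicE memNset// mule0 (_ : [set _ | _] = set0) ?setI0; last first.
    by apply/seteqP; split.
  by rewrite measure0; split=> //; exact: indep_of_set0.
move=> /andP[js us] /andP[Aj sA] indE.
pose Ek k := E `&` Y j @^-1` (@zcode p @^-1` [set k]).
pose Fk k := Ek k `&` [set w | B (zdecode p k + \sum_(i <- s) Y i w)].
have -> : E `&` [set w | B (\sum_(i <- j :: s) Y i w)] = \bigcup_k Fk k.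
  rewrite [LHS](bigcup_levelI (Y j)); apply: eq_bigcupr => k _.
  apply/seteqP; split=> w.
    move=> [[Ew /=]]; rewrite big_cons => Bw lw; split; first by split.
    by rewrite /= -(levelE lw).
  move=> [[Ew lw]] /=; rewrite -(levelE lw) => Bw; split=> //; split=> //=.
  by rewrite big_cons.
have tF : trivIset setT Fk.
  by apply: (@trivIset_levelI _ _ (Y j)) => k w [[]].
have indFk k := ih [pred i | A i && (i != j)] (Ek k)
  [set z | B (zdecode p k + z)] us.
have sA' : all [pred i | A i && (i != j)] s.
  apply/allP => i is_ /=; rewrite (allP sA)//=.
  by apply: contraNneq js => <-.
have {}indFk k := indFk k sA' (indep_ofI _ indE Aj).1.
split.
  apply: indep_of_bigcup => // k; apply: sub_indep_of (indFk k).1 => i /=.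
  by rewrite inE negb_or andbA.
rewrite measure_semi_bigcup//; last 2 first.
- by move=> k; case: (indFk k) => -[].
- by apply: bigcupT_measurable => k; case: (indFk k) => -[].
rewrite -[P E]fineK ?fin_num_measure ?indE.1//; last by case: indE.
rewrite -nneseriesZl; last by move=> k _; rewrite mule_ge0// sum_law_ge0.
apply: eq_eseriesr => k _; rewrite [LHS](indFk k).2 (indep_ofI _ indE Aj).2.
by rewrite fineK ?muleA// fin_num_measure//; case: indE.
Qed.

End independence.

(** * The Markov property *)

Lemma probability_integral_cst d (T : measurableType d) (R : realType)
    (P : probability T R) (c : \bar R) : (\int[P]_x c = c)%E.
Proof.
rewrite integral_cst// -[RHS]mule1; congr (_ * _)%E; exact: probability_setT.
Qed.

Lemma integral_zvec_series (R : realType) (p : nat)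
    (nu : {measure set zvec p -> \bar R}) (g : zvec p -> \bar R) :
  (forall x, 0 <= g x)%E ->
  (\int[nu]_x g x =
   \sum_(k <oo) g (zdecode p k) * nu (@zcode p @^-1` [set k]))%E.
Proof.
move=> g0; pose A k := @zcode p @^-1` [set k].
have gE x : (g x = \sum_(k <oo) g (zdecode p k) * (\1_(A k) x)%:E)%E.
  rewrite (@nneseriesD1 _ _ (zcode x))//; last first.
    by move=> k _; rewrite mule_ge0// lee_fin.
  rewrite zcodeK indicE mem_set//= mule1 eseries0 ?adde0// => k _ kx.
  by rewrite indicE memNset ?mule0// => /= xk; rewrite xk eqxx in kx.
rewrite (eq_integral _ _ (fun x _ => gE x)) integral_nneseries//; last first.
  by move=> k x _; rewrite mule_ge0// lee_fin.
apply: eq_eseriesr => k _.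
by rewrite ge0_integralZl// integral_indic// setIT.
Qed.

(** Every nonnegative [g] is a countable combination of indicators of single states, and such series
    commute with the outer integral. *)
Lemma integral_zvec_bind (R : realType) (p q : nat)
    (mu : {measure set zvec p -> \bar R}) (nu : {measure set zvec q -> \bar R})
    (k : zvec p -> {measure set zvec q -> \bar R}) (g : zvec q -> \bar R) :
  (forall B, nu B = \int[mu]_x k x B)%E -> (forall y, 0 <= g y)%E ->
  (\int[nu]_y g y = \int[mu]_x \int[k x]_y g y)%E.
Proof.
move=> nuE g0; rewrite integral_zvec_series//.
under [RHS]eq_integral do rewrite integral_zvec_series//.
rewrite integral_nneseries//; last by move=> n x _; exact: mule_ge0.
apply: eq_eseriesr => n _.
by rewrite nuE ge0_integralZl.
Qed.

Section gw_markov.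
Context (R : realType) (p : nat) (d : measure_display) (W : measurableType d).
Context (P : probability W R).
Context (xi : 'I_p -> nat -> nat -> {RV P >-> zvec p}).
Context (eta : nat -> {RV P >-> zvec p}).
Implicit Types (x y : zvec p) (B : set (zvec p)).

Lemma measurable_fun_gw_step n x : measurable_fun setT (gw_step xi eta n x).
Proof.
have mD (f g : W -> zvec p) : measurable_fun setT f -> measurable_fun setT g ->
    measurable_fun setT (fun w => f w + g w).
  move=> mf mg.
  apply: (@measurable_fun_select _ _ _ _ f (fun a w => a + g w)) => // a.
  exact: (measurableT_comp (measurable_fun_zvec (fun b => a + b)) mg).
have mS I (s : seq I) (f : I -> W -> zvec p) :
    (forall i, measurable_fun setT (f i)) ->
    measurable_fun setT (fun w => \sum_(i <- s) f i w).
  move=> mf; elim: s => [|i s ih].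
    by under eq_fun do rewrite big_nil; exact: measurable_cst.
  by under eq_fun do rewrite big_cons; exact: mD.
by apply: (mD) => //; apply: (mS) => i; apply: (mS).
Qed.

HB.instance Definition _ n x :=
  isMeasurableFun.Build _ _ _ _ (gw_step xi eta n x) (measurable_fun_gw_step n x).

Lemma measurable_fun_gw_from x n : measurable_fun setT (gw_from xi eta x n).
Proof.
elim: n => [|n ih] /=; first exact: measurable_cst.
by apply: (measurable_fun_select ih) => y.
Qed.

HB.instance Definition _ x n :=
  isMeasurableFun.Build _ _ _ _ (gw_from xi eta x n) (measurable_fun_gw_from x n).

Definition gw_law x n : probability (zvec p) R :=
  distribution P (gw_from xi eta x n).

Local Notation index := (unit + ('I_p * nat * nat) + nat)%type.

Definition step_index n x : seq index :=
  [seq inl (inr (i, n, k)) | i <- enum 'I_p, k <- iota 0 (x ord0 i)] ++ [:: inr n].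

(** The offspring and innovation variables that have not acted by time [n]. The initial vector is
    left out, since the chain studied starts at a fixed state. *)
Definition not_before n (j : index) : bool :=
  match j with
  | inl (inl _) => false
  | inl (inr (_, m, _)) => (n <= m)%N
  | inr m => (n <= m)%N
  end.

Lemma gw_stepE X0 n x w :
  gw_step xi eta n x w = \sum_(j <- step_index n x) gw_family xi eta X0 j w.
Proof.
rewrite /step_index big_cat big_allpairs_dep big_seq1 /=; congr (_ + _).
rewrite big_enum; apply: eq_bigr => i _.
by rewrite -(big_mkord xpredT (fun k => xi i n k w)) /index_iota subn0.
Qed.

Lemma step_index_uniq n x : uniq (step_index n x).
Proof.
rewrite cat_uniq andbT allpairs_uniq_dep ?enum_uniq//=.
- by rewrite orbF; apply/allpairsPdep => -[i [k []]].
- by move=> i _; exact: iota_uniq.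
- by move=> [i k] [i' k'] _ _ /= [-> ->].
Qed.

Lemma step_index_not_before n x : all (not_before n) (step_index n x).
Proof.
rewrite all_cat /= leqnn !andbT; apply/allP => j /allpairsPdep [i [k [_ _ ->]]].
by rewrite /= leqnn.
Qed.

Lemma not_before_notin_step_index n x :
  subpred (not_before n.+1)
          [pred j | not_before n j && (j \notin step_index n x)].
Proof.
move=> j /= nj; rewrite mem_cat negb_or mem_seq1; apply/and3P; split.
- by case: j nj => [[//|[[i m] k]]|m] /= /ltnW.
- apply/negP => /allpairsPdep [i [k [_ _ jE]]].
  by move: nj; rewrite jE /= ltnn.
- by apply/negP => /eqP jE; move: nj; rewrite jE /= ltnn.
Qed.

Variable X : nat -> {RV P >-> zvec p}.
Hypothesis gwX : gw_process xi eta X.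

Let Y := gw_family xi eta (X 0%N).
Let law j B := P (Y j @^-1` B).

Lemma gw_step_sum_law n x B :
  P (gw_step xi eta n x @^-1` B) = sum_law (map law (step_index n x)) B.
Proof.
have [_] := indep_of_sum B (step_index_uniq n x) (step_index_not_before n x)
  (indep_of_setT _ (gw_indep gwX)).
rewrite setTI probability_setT mul1e => <-; congr (P _).
by apply/seteqP; split=> w /=; rewrite -gw_stepE.
Qed.

(** The law of a step is a convolution determined by the laws of the variables involved, and these
    agree at times [n] and [0], index by index. *)
Lemma gw_step_homogeneous n x B :
  P (gw_step xi eta n x @^-1` B) = P (gw_step xi eta 0 x @^-1` B).
Proof.
rewrite !gw_step_sum_law /step_index !map_cat !map_allpairs /=.
congr (sum_law (_ ++ [:: _])).
  apply: eq_allpairs => // i k; apply/funext => C.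
  rewrite /law /= -[LHS]/(distribution P (xi i n k) C).
  by rewrite (gw_offspring_id gwX) -(gw_offspring_id gwX i 0 k).
by apply/funext => C; exact: (gw_innovation_id gwX).
Qed.

Lemma gw_from_split x n B :
  (gw_from xi eta x n.+1 @^-1` B) =
  \bigcup_k (gw_from xi eta x n @^-1` (@zcode p @^-1` [set k]) `&`
             [set w | B (\sum_(j <- step_index n (zdecode p k)) Y j w)]).
Proof.
rewrite [LHS](bigcup_levelI (gw_from xi eta x n)); apply: eq_bigcupr => k _.
apply/seteqP; split=> w /= [].
  by move=> Bw lw; split=> //; rewrite -gw_stepE -(levelE lw).
by move=> lw; rewrite -gw_stepE -(levelE lw).
Qed.

(** The state at time [n.+1] is a function of the state at time [n] and of the variables in
    [step_index n]. After partitioning by the former, [indep_of_sum] discards those indices, none of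
    which satisfies [not_before n.+1]. *)
Lemma gw_from_indep x n B :
  indep_of Y (not_before n) (gw_from xi eta x n @^-1` B).
Proof.
elim: n B => [|n ih] B.
  have [Bx|Bx] := pselect (B x).
    rewrite (_ : _ @^-1` B = setT); first exact: indep_of_setT (gw_indep gwX).
    by apply/seteqP; split.
  rewrite (_ : _ @^-1` B = set0); first exact: indep_of_set0.
  by apply/seteqP; split.
rewrite gw_from_split; apply: indep_of_bigcup => [|k].
  by apply: (@trivIset_levelI _ _ (gw_from xi eta x n)) => k w [].
apply: (sub_indep_of (@not_before_notin_step_index n (zdecode p k))).
by apply: (indep_of_sum _ (step_index_uniq _ _) (step_index_not_before _ _) _).1.
Qed.

(** The Markov property: the state at time [n] is independent of the variables of step [n], and
    homogeneity replaces that step by step [0]. *)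
Lemma gw_law_last_step x n B :
  (gw_law x n.+1 B = \int[gw_law x n]_y gw_law y 1 B)%E.
Proof.
rewrite integral_zvec_series//.
rewrite -[LHS]/(P (gw_from xi eta x n.+1 @^-1` B)) gw_from_split.
rewrite measure_semi_bigcup; last 3 first.
- move=> k; have [] := (indep_of_sum B (step_index_uniq n (zdecode p k))
    (step_index_not_before _ _) (gw_from_indep x n (@zcode p @^-1` [set k]))).1.
  by [].
- by apply: (@trivIset_levelI _ _ (gw_from xi eta x n)) => k w [].
- rewrite -gw_from_split; exact: measurable_funPTI.
apply: eq_eseriesr => k _.
rewrite [LHS](indep_of_sum _ (step_index_uniq _ _) (step_index_not_before _ _)
  (gw_from_indep _ _ _)).2.
by rewrite -gw_step_sum_law gw_step_homogeneous muleC.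
Qed.

Lemma gw_law0 x (f : zvec p -> \bar R) : (forall y, 0 <= f y)%E ->
  (\int[gw_law x 0]_y f y = f x)%E.
Proof.
move=> f0; rewrite ge0_integral_distribution//=.
exact: probability_integral_cst.
Qed.

(** Derived from the last-step form by induction on [n]; conditioning on the first step directly
    would require shifting the driving variables in time. *)
Lemma gw_law_first_step x n (f : zvec p -> \bar R) : (forall y, 0 <= f y)%E ->
  (\int[gw_law x n.+1]_y f y = \int[gw_law x 1]_y \int[gw_law y n]_z f z)%E.
Proof.
elim: n f => [|n ih] f f0.
  by apply: eq_integral => y _; rewrite gw_law0.
have step y m : (\int[gw_law y m.+1]_z f z =
    \int[gw_law y m]_z \int[gw_law z 1]_t f t)%E.
  by apply: integral_zvec_bind => // B; exact: gw_law_last_step.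
rewrite step ih; last by move=> y; exact: integral_ge0.
by apply: eq_integral => y _; rewrite step.
Qed.

(** As an integral over [W], the formula lets chains from two starting points be compared through
    the same first-step variables. *)
Lemma gw_prob_first_step x n B :
  (gw_prob xi eta x n.+1 B =
   \int[P]_w gw_prob xi eta (gw_step xi eta 0 x w) n B)%E.
Proof.
transitivity (\int[gw_law x n.+1]_y (\1_B y)%:E)%E.
  by rewrite integral_indic// setIT.
rewrite gw_law_first_step; last by move=> y; rewrite lee_fin.
rewrite ge0_integral_distribution//; last first.
  by move=> y; apply: integral_ge0 => z _; rewrite lee_fin.
by apply: eq_integral => w _ /=; rewrite integral_indic// setIT.
Qed.

End gw_markov.

(** * Contraction *)

Lemma powR_le_1D (R : realType) (t a b : R) :
  0 <= t -> 0 < a -> a <= b -> t `^ a <= 1 + t `^ b.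
Proof.
move=> t0 a0 ab; have [t1|/ltW t1] := leP t 1.
  have : t `^ a <= 1 `^ a by rewrite ge0_ler_powR ?nnegrE// ltW.
  by rewrite powR1 => /le_trans; apply; rewrite lerDl powR_ge0.
by apply: le_trans (ler_powR t1 ab) _; rewrite lerDr.
Qed.

Lemma min1_le_powR (R : realType) (t b : R) :
  0 <= t -> 0 < b <= 1 -> Num.min 1 t <= t `^ b.
Proof.
move=> t0 /andP[b0 b1]; have [t1|/ltW t1] := leP 1 t.
  by have := ler_powR t1 (ltW b0); rewrite powRr0.
have [->|tn0] := eqVneq t 0; first exact: powR_ge0.
by have := @ger_powR _ t _ _ _ b1; rewrite lt0r tn0 t0 t1 powRr1// => /(_ isT).
Qed.

Section weight.
Context (R : realType) (p : nat) (v : 'I_p -> R).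
Implicit Types (x y : zvec p) (f : zvec p -> \bar R).

Definition weight x : R := \sum_j v j * (x ord0 j)%:R.

Definition unit_vec (i : 'I_p) : zvec p := \row_j (i == j : nat).

Lemma weight_unit_vec i : weight (unit_vec i) = v i.
Proof.
rewrite /weight (bigD1 i)//= mxE eqxx mulr1 big1 ?addr0// => j ji.
by rewrite mxE eq_sym (negbTE ji) mulr0.
Qed.

Lemma weightD x y : weight (x + y) = weight x + weight y.
Proof.
by rewrite /weight -big_split; apply: eq_bigr => j _; rewrite mxE natrD mulrDr.
Qed.

(** Two additive inequalities avoid a difference of extended reals. *)
Definition lipschitz (K : R) f := forall x i,
  (f (x + unit_vec i)%R <= f x + (K * v i)%:E)%E /\
  (f x <= f (x + unit_vec i)%R + (K * v i)%:E)%E.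

Lemma zvec_decomp y : y = 0 \/ exists i y', y = y' + unit_vec i.
Proof.
have [[i yi]|y0] := pselect (exists i, (0 < y ord0 i)%N).
  right; exists i, (\row_j (y ord0 j - (i == j))%N).
  apply/rowP => j; rewrite !mxE; case: eqP => [<-|_]; last by rewrite subn0 addr0.
  by rewrite -[RHS]/(_ + _)%N subnK.
left; apply/rowP => j; rewrite mxE; apply/eqP; rewrite -leqn0 leqNgt.
by apply/negP => yj; apply: y0; exists j.
Qed.

Lemma lipschitzP K f : lipschitz K f -> forall x y,
  (f (x + y)%R <= f x + (K * weight y)%:E)%E /\
  (f x <= f (x + y)%R + (K * weight y)%:E)%E.
Proof.
move=> lipf x y; have [n] := ubnP (\sum_j y ord0 j)%N.
elim: n y => // n ih y; have [->|[i [y' ->]]] := zvec_decomp y.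
  by move=> _; rewrite addr0 /weight big1 ?mulr0 ?adde0// => j _; rewrite mxE mulr0.
have -> : (\sum_j (y' + unit_vec i)%R ord0 j = (\sum_j y' ord0 j).+1)%N.
  have ui : (\sum_j (unit_vec i) ord0 j = 1)%N.
    rewrite (bigD1 i)//= mxE eqxx big1 ?addn0// => j ji.
    by rewrite mxE eq_sym (negbTE ji).
  rewrite -[RHS]addn1 -[X in (_ + X)%N]ui.
  by rewrite -big_split; apply: eq_bigr => j _; rewrite mxE.
rewrite ltnS => /ih[le1 le2]; have [le3 le4] := lipf (x + y') i.
rewrite addrA weightD weight_unit_vec mulrDr EFinD; split.
  by apply: le_trans le3 _; rewrite addeA; exact: leeD2r.
apply: le_trans le2 _; rewrite [((K * weight y')%:E + _)%E]addeC addeA.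
exact: leeD2r.
Qed.

End weight.

Section contraction.
Context (R : realType) (p : nat) (d : measure_display) (W : measurableType d).
Context (P : probability W R).
Context (xi : 'I_p -> nat -> nat -> {RV P >-> zvec p}).
Context (eta : nat -> {RV P >-> zvec p}).
Context (X : nat -> {RV P >-> zvec p}).
Hypothesis gwX : gw_process xi eta X.
Context (rho : R) (v : 'I_p -> R).
Hypothesis rho01 : 0 < rho < 1.
Hypothesis v_ge1 : forall i, 1 <= v i.
Hypothesis xi_int : offspring_integrable xi.
Hypothesis M_v : forall i, \sum_j mean_matrix xi i j * v j <= rho * v i.

Local Notation weight := (weight v).
Local Notation prob x n B := (gw_prob xi eta x n B).

Lemma weight_ge0 x : 0 <= weight x.
Proof.
by apply: sumr_ge0 => j _; rewrite mulr_ge0// (le_trans ler01).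
Qed.

Lemma measurable_fun_RV (Z : {RV P >-> zvec p}) (f : zvec p -> \bar R) :
  measurable_fun setT (fun w => f (Z w)).
Proof. exact: (measurableT_comp (measurable_fun_zvec f)). Qed.

(** By equality in law and linearity, the left-hand side is entry [i] of [M v]. *)
Lemma offspring_weight i k :
  (\int[P]_w (weight (xi i 0 k w))%:E <= (rho * v i)%:E)%E.
Proof.
have -> : (\int[P]_w (weight (xi i 0 k w))%:E =
          \int[P]_w (weight (xi i 0 0 w))%:E)%E.
  pose f x := (weight x)%:E.
  have f0 x : (0 <= f x)%E by rewrite lee_fin weight_ge0.
  rewrite -(@ge0_integral_distribution _ _ _ _ _ P (xi i 0 k) f)//.
  rewrite -(@ge0_integral_distribution _ _ _ _ _ P (xi i 0 0) f)//.
  by apply: eq_measure_integral => B _ _; exact: (gw_offspring_id gwX).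
have v0 j : 0 <= v j by exact: le_trans (v_ge1 j).
under eq_integral do rewrite -sumEFin.
rewrite ge0_integral_sum//; last 2 first.
- move=> j.
  exact: (@measurable_fun_RV (xi i 0 0) (fun x => (v j * (x ord0 j)%:R)%:E)).
- by move=> j w _; rewrite lee_fin mulr_ge0.
apply: le_trans (_ : (\sum_j mean_matrix xi i j * v j)%:E <= _)%E; last first.
  by rewrite lee_fin M_v.
(* Integrability ensures that the [fine] in [mean_matrix] loses nothing. *)
rewrite -sumEFin; apply: lee_sum => j _; rewrite mxE mulrC EFinM fineK; last first.
  by rewrite unlock; apply: integrable_fin_num (xi_int i j).
rewrite unlock -ge0_integralZl//.
- exact: (@measurable_fun_RV (xi i 0 0) (fun x => ((x ord0 j)%:R)%:E)).
- by rewrite lee_fin.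
Qed.

Lemma gw_step_unit_vec n x i w :
  gw_step xi eta n (x + unit_vec i) w = gw_step xi eta n x w + xi i n (x ord0 i) w.
Proof.
rewrite /gw_step -!addrA [eta n w + _]addrC addrA; congr (_ + _).
under eq_bigr => j _ do rewrite -(big_mkord xpredT (fun k => xi j n k w)).
under [in RHS]eq_bigr => j _ do rewrite -(big_mkord xpredT (fun k => xi j n k w)).
have xE j : (x + unit_vec i)%R ord0 j = (x ord0 j + (i == j))%N by rewrite !mxE.
rewrite (bigD1 i)//= [in RHS](bigD1 i)//= xE eqxx addn1 big_nat_recr//=.
rewrite -!addrA; congr (_ + _); rewrite addrC; congr (_ + _).
by apply: eq_bigr => j ji; rewrite xE eq_sym (negbTE ji) addn0.
Qed.

Lemma gw_prob_le1 x n B : (prob x n B <= 1)%E.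
Proof. exact: (@probability_le1 _ _ _ (gw_law xi eta x n)). Qed.

Lemma gw_prob_lipschitz n B : lipschitz v (rho ^+ n) (fun x => prob x n B).
Proof.
have v0 j : 0 <= v j by exact: le_trans (v_ge1 j).
have rho0 m : 0 <= rho ^+ m by rewrite exprn_ge0//; case/andP: rho01 => /ltW.
elim: n => [|n ih] x i.
  (* At time [0], two probabilities differ by at most [1], and [1 <= v i]. *)
  have le1 a b : (0 <= a)%E -> (b <= 1)%E -> (b <= a + (rho ^+ 0 * v i)%:E)%E.
    move=> a0 /le_trans; apply; rewrite -[leLHS]add0e leeD// expr0 mul1r.
    by rewrite lee_fin.
  by split; apply: le1 => //; exact: gw_prob_le1.
(* By the coupling, the states after one step differ by a single offspring vector. The induction
   hypothesis bounds the effect by [rho ^+ n] times its weight, whose mean is at most [rho * v i].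
   Used in both directions. *)
have le2 (F G : W -> \bar R) : (forall w, 0 <= F w)%E -> (forall w, 0 <= G w)%E ->
    measurable_fun setT F -> measurable_fun setT G ->
    (forall w, F w <= G w + (rho ^+ n * weight (xi i 0 (x ord0 i) w))%:E)%E ->
    (\int[P]_w F w <= \int[P]_w G w + (rho ^+ n.+1 * v i)%:E)%E.
  move=> F0 G0 mF mG FG.
  have mV : measurable_fun setT (fun w => (weight (xi i 0 (x ord0 i) w))%:E).
    exact: (@measurable_fun_RV (xi i 0 (x ord0 i)) (fun x => (weight x)%:E)).
  apply: le_trans (_ : \int[P]_w (G w + (rho ^+ n)%:E *
      (weight (xi i 0 (x ord0 i) w))%:E) <= _)%E.
    apply: ge0_le_integral => //.
    by apply: emeasurable_funD => //; exact: emeasurable_funM.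
  rewrite ge0_integralD//; last 2 first.
  - by move=> w _; rewrite -EFinM lee_fin mulr_ge0// weight_ge0.
  - exact: emeasurable_funM.
  rewrite leeD2l// ge0_integralZl//; last 2 first.
  - by move=> w _; rewrite lee_fin weight_ge0.
  - by rewrite lee_fin.
  by rewrite exprSr -mulrA EFinM lee_wpmul2l ?lee_fin// offspring_weight.
rewrite !(gw_prob_first_step gwX).
have m1 := @measurable_fun_RV (gw_step xi eta 0 x) (fun y => prob y n B).
have m2 := @measurable_fun_RV (gw_step xi eta 0 (x + unit_vec i))
  (fun y => prob y n B).
by split; apply: le2 => // w; rewrite gw_step_unit_vec;
  case: (lipschitzP ih (gw_step xi eta 0 x w) (xi i 0 (x ord0 i) w)).
Qed.

Lemma gw_prob_origin n B x :
  (prob x n B <= prob 0%R n B + (rho ^+ n * weight x)%:E)%E /\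
  (prob 0%R n B <= prob x n B + (rho ^+ n * weight x)%:E)%E.
Proof. by have := lipschitzP (gw_prob_lipschitz n B) 0 x; rewrite add0r. Qed.

Lemma rho_weight_powR n x (b : R) :
  (rho ^+ n * weight x) `^ b = (rho `^ b) ^+ n * weight x `^ b.
Proof.
have rho0 : 0 <= rho by case/andP: rho01 => /ltW.
rewrite powRM ?exprn_ge0 ?weight_ge0//; congr (_ * _).
by rewrite -(powR_mulrn n rho0) -(powR_mulrn n (powR_ge0 rho b)) -!powRrM mulrC.
Qed.

(** Lowering the exponent of the weight to [b] slows the rate, but leaves a bound that can be
    integrated when the innovations have only a fractional moment. *)
Lemma gw_prob_origin_powR n B x (b : R) : 0 < b <= 1 ->
  (prob x n B <= prob 0%R n B + ((rho `^ b) ^+ n * weight x `^ b)%:E)%E /\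
  (prob 0%R n B <= prob x n B + ((rho `^ b) ^+ n * weight x `^ b)%:E)%E.
Proof.
move=> b01; rewrite -rho_weight_powR.
set t := rho ^+ n * weight x.
have t0 : 0 <= t.
  by rewrite mulr_ge0 ?weight_ge0// exprn_ge0//; case/andP: rho01 => /ltW.
have tb := min1_le_powR t0 b01.
have le3 (f g : \bar R) : (0 <= g -> f <= 1 -> f <= g + t%:E ->
    f <= g + (t `^ b)%:E)%E.
  move=> g0 f1 fg; apply: le_trans (_ : g + (Num.min 1 t)%:E <= _)%E.
    have [_|//] := leP 1 t.
    by apply: (le_trans f1); rewrite -[leLHS]add0e leeD2r.
  by rewrite leeD2l// lee_fin.
by have [] := gw_prob_origin n B x; split; apply: le3 => //; exact: gw_prob_le1.
Qed.

Lemma fin_num_gw_prob x n B : prob x n B \is a fin_num.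
Proof. exact: (@fin_num_measure _ _ _ (gw_law xi eta x n)). Qed.

Lemma gw_prob_increment n B (b K : R) : 0 < b <= 1 ->
  (\int[P]_w (weight (eta 0 w) `^ b)%:E <= K%:E)%E ->
  `|fine (prob 0%R n.+1 B) - fine (prob 0%R n B)| <= (rho `^ b) ^+ n * K.
Proof.
move=> b01 etaK.
have r0 : 0 <= (rho `^ b) ^+ n by rewrite exprn_ge0// powR_ge0.
(* With no ancestors, the first generation is the first innovation vector. *)
have step w : gw_step xi eta 0 0 w = eta 0 w.
  rewrite /gw_step big1 ?add0r// => i _; rewrite big1// => -[k].
  by rewrite mxE.
have E : (prob 0%R n.+1 B = \int[P]_w prob (eta 0%N w) n B)%E.
  by rewrite (gw_prob_first_step gwX); apply: eq_integral => w _; rewrite step.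
have m1 := @measurable_fun_RV (eta 0) (fun y => prob y n B).
have m2 := @measurable_fun_RV (eta 0) (fun y => (weight y `^ b)%:E).
have int1 : (\int[P]_w prob 0%R n B = prob 0%R n B)%E.
  exact: probability_integral_cst.
have le4 (F G : W -> \bar R) : (forall w, 0 <= F w)%E -> (forall w, 0 <= G w)%E ->
    measurable_fun setT F -> measurable_fun setT G ->
    (forall w, F w <= G w + ((rho `^ b) ^+ n * weight (eta 0 w) `^ b)%:E)%E ->
    (\int[P]_w F w <= \int[P]_w G w + ((rho `^ b) ^+ n * K)%:E)%E.
  move=> F0 G0 mF mG FG.
  apply: le_trans (_ : \int[P]_w (G w + ((rho `^ b) ^+ n)%:E *
      (weight (eta 0 w) `^ b)%:E) <= _)%E.
    by apply: ge0_le_integral => //;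
      apply: emeasurable_funD => //; exact: emeasurable_funM.
  rewrite ge0_integralD//; last 2 first.
  - by move=> w _; rewrite -EFinM lee_fin mulr_ge0// powR_ge0.
  - exact: emeasurable_funM.
  rewrite leeD2l// ge0_integralZl//; last first.
    by move=> w _; rewrite lee_fin powR_ge0.
  by rewrite EFinM lee_wpmul2l ?lee_fin.
have lip w := gw_prob_origin_powR n B (eta 0 w) b01.
have le5 : (prob 0%R n.+1 B <= prob 0%R n B + ((rho `^ b) ^+ n * K)%:E)%E.
  by rewrite E -[in leRHS]int1; apply: le4 => // w; case: (lip w).
have le6 : (prob 0%R n B <= prob 0%R n.+1 B + ((rho `^ b) ^+ n * K)%:E)%E.
  by rewrite E -[in leLHS]int1; apply: le4 => // w; case: (lip w).
have := le5; have := le6.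
rewrite -(fineK (fin_num_gw_prob 0 n B)) -(fineK (fin_num_gw_prob 0 n.+1 B)) /=.
by rewrite -!EFinD !lee_fin ler_norml => ? ?; apply/andP; split; lra.
Qed.

(** With [C] the sum of the [v j], the weight is at most [C] times the norm; since [b <= alpha], the
    power [b] of the norm is at most [1] plus its power [alpha]. *)
Lemma innovation_weight (alpha : R) : 0 < alpha ->
  ('E_P[fun w => (l1norm R (eta 0%N w) `^ alpha)%R] < +oo)%E ->
  exists K, (\int[P]_w (weight (eta 0 w) `^ Num.min alpha 1)%:E <= K%:E)%E.
Proof.
move=> alpha0; rewrite unlock => int_fin; set b := Num.min alpha 1.
have b0 : 0 < b by rewrite lt_min alpha0 ltr01.
pose C := \sum_j v j.
have v0 j : 0 <= v j by exact: le_trans (v_ge1 j).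
have C0 : 0 <= C by exact: sumr_ge0.
have l1_ge0 (x : zvec p) : 0 <= l1norm R x by exact: sumr_ge0.
have wC x : weight x <= C * l1norm R x.
  rewrite mulr_sumr; apply: ler_sum => j _; apply: ler_wpM2r => //.
  by rewrite /C (bigD1 j)//= lerDl sumr_ge0.
have m1 := @measurable_fun_RV (eta 0) (fun y => (l1norm R y `^ alpha)%:E).
exists (C `^ b * (1 + fine (\int[P]_w (l1norm R (eta 0 w) `^ alpha)%:E))).
apply: le_trans (_ : \int[P]_w ((C `^ b)%:E *
    (1 + (l1norm R (eta 0 w) `^ alpha)%:E)) <= _)%E.
  apply: ge0_le_integral => //.
  - by move=> w _; rewrite lee_fin powR_ge0.
  - exact: (@measurable_fun_RV (eta 0) (fun y => (weight y `^ b)%:E)).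
  - by apply: emeasurable_funM => //; exact: emeasurable_funD.
  move=> w _; rewrite -EFinD -EFinM lee_fin.
  apply: le_trans (_ : (C * l1norm R (eta 0 w)) `^ b <= _).
    by rewrite ge0_ler_powR ?nnegrE ?weight_ge0 ?mulr_ge0// ltW.
  rewrite powRM// ler_wpM2l ?powR_ge0// powR_le_1D//.
  by rewrite ge_min lexx.
rewrite ge0_integralZl//; last 3 first.
- exact: emeasurable_funD.
- by move=> w _; rewrite -EFinD lee_fin addr_ge0// powR_ge0.
- by rewrite lee_fin powR_ge0.
rewrite ge0_integralD//; last by move=> w _; rewrite lee_fin powR_ge0.
rewrite probability_integral_cst EFinM EFinD fineK//.
rewrite ge0_fin_numE//; apply: integral_ge0 => w _; by rewrite lee_fin powR_ge0.
Qed.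

End contraction.

(** * Uniform limits of probability measures *)

(** The bound is the tail of the geometric series that controls the later increments. Subtracted
    from [a n] it gives a nondecreasing sequence, added to [a n] a nonincreasing one; [l] is the
    supremum of the former and lies below the latter. *)
Lemma geometric_increments_limit (R : realType) (a : nat -> R) (r K : R) :
  0 <= r < 1 -> 0 <= K -> (forall n, `|a n.+1 - a n| <= r ^+ n * K) ->
  exists l, forall n, `|a n - l| <= r ^+ n * (K / (1 - r)).
Proof.
move=> /andP[r0 r1] K0 aK; set K' := K / (1 - r).
have KE : K = K' * (1 - r) by rewrite divfK// subr_eq0 gt_eqF.
have lo : nondecreasing_seq (fun n => a n - r ^+ n * K').
  apply/nondecreasing_seqP => n; have := aK n.
  by rewrite KE exprSr ler_norml => /andP[? _]; nra.
have hi : nonincreasing_seq (fun n => a n + r ^+ n * K').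
  apply/nonincreasing_seqP => n; have := aK n.
  by rewrite KE exprSr ler_norml => /andP[_ ?]; nra.
have K'0 n : 0 <= r ^+ n * K'.
  by rewrite mulr_ge0 ?exprn_ge0// divr_ge0// subr_ge0 ltW.
have lohi m n : a m - r ^+ m * K' <= a n + r ^+ n * K'.
  apply: le_trans (lo _ _ (leq_maxl m n)) _.
  apply: le_trans (hi _ _ (leq_maxr m n)).
  by have := K'0 (maxn m n); lra.
exists (sup (range (fun n => a n - r ^+ n * K'))) => n.
have le1 : a n - r ^+ n * K' <= sup (range (fun n => a n - r ^+ n * K')).
  by apply: ub_le_sup; [exists (a 0 + r ^+ 0 * K') => _ [m _ <-]|exists n].
have le2 : sup (range (fun n => a n - r ^+ n * K')) <= a n + r ^+ n * K'.
  by apply: ge_sup; [exists (a 0 - r ^+ 0 * K'), 0%N|move=> _ [m _ <-]].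
by rewrite ler_norml; apply/andP; split; lra.
Qed.

Lemma cvg_dist_le (R : realType) (a eps : nat -> R) (l : R) :
  eps @ \oo --> 0 -> (forall n, `|a n - l| <= eps n) -> a @ \oo --> l.
Proof.
move=> eps0 al; apply/cvgrPdist_le => e e0.
have /cvgrPdist_le/(_ e e0) := eps0; apply: filterS => n.
rewrite sub0r normrN distrC => epse.
exact: le_trans (al n) (le_trans (ler_norm _) epse).
Qed.

Section uniform_setwise_limit.
Context d (T : measurableType d) (R : realType).
Context (mu : nat -> probability T R) (nu : set T -> R) (eps : nat -> R).
Hypothesis eps0 : eps @ \oo --> 0.
Hypothesis mu_nu : forall n A, `|fine (mu n A) - nu A| <= eps n.

Lemma cvg_uniform_limit A : (fun n => fine (mu n A)) @ \oo --> nu A.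
Proof.
by apply: cvg_dist_le eps0 _ => n; exact: mu_nu.
Qed.

Definition uniform_limit (A : set T) : \bar R := (nu A)%:E.

Let limit0 : uniform_limit set0 = 0%E.
Proof.
congr EFin; rewrite -(cvg_lim _ (@cvg_uniform_limit set0))//.
rewrite (_ : (fun _ => _) = cst 0) ?lim_cst//.
by apply/funext => n; rewrite [mu n set0]measure0.
Qed.

Let limit_ge0 A : (0 <= uniform_limit A)%E.
Proof.
rewrite lee_fin -(cvg_lim _ (@cvg_uniform_limit A))//; apply: limr_ge.
  by apply/cvg_ex; exists (nu A); exact: cvg_uniform_limit.
by apply: nearW => n; rewrite fine_ge0.
Qed.

Let limit_sum (F : nat -> set T) k : (forall i, measurable (F i)) ->
  trivIset setT F -> nu (\big[setU/set0]_(i < k) F i) = \sum_(i < k) nu (F i).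
Proof.
move=> mF tF.
rewrite -(cvg_lim _ (@cvg_uniform_limit (\big[setU/set0]_(i < k) F i)))//.
rewrite (_ : (fun _ => _) = (fun n => \sum_(i < k) fine (mu n (F i)))).
  apply: cvg_lim => //; apply: cvg_big => [|i _]; last exact: cvg_uniform_limit.
  exact: add_continuous.
apply/funext => n; rewrite [mu n _]measure_bigsetU// -sum_fine// => i _.
exact: fin_num_measure.
Qed.

(* Uniformity is what makes the limit countably additive. *)
Let limit_sigma_additive : semi_sigma_additive uniform_limit.
Proof.
move=> F mF tF mUF.
rewrite (_ : (fun _ => _) =
    EFin \o (fun k => nu (\big[setU/set0]_(i < k) F i))); last first.
  by apply/funext => k; rewrite /= limit_sum// -sumEFin big_mkord.
apply: cvg_EFin; first exact: nearW.
(* Passing from [nu] to one fixed [mu n] costs at most [e / 3] on the partial union and on the whole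
   union; the last third goes to the countable additivity of [mu n]. *)
apply/cvgrPdist_le => e e0; have e30 : 0 < e / 3 by rewrite divr_gt0.
have [n /= _ /(_ n (leqnn n))] := (cvgrPdist_le _ _).1 eps0 _ e30.
rewrite /= sub0r normrN => /(le_trans (ler_norm _)) epsn.
have /fine_cvgP[_ /cvgrPdist_le/(_ _ e30)] :
    (fun k => \sum_(0 <= i < k) mu n (F i))%E @ \oo --> (fine (mu n (\bigcup_i F i)))%:E.
  rewrite fineK ?fin_num_measure//; exact: measure_semi_sigma_additive.
apply: filterS => k /=; rewrite big_mkord -measure_bigsetU// => muk.
have := mu_nu n (\bigcup_i F i); have := mu_nu n (\big[setU/set0]_(i < k) F i).
move: muk; rewrite !ler_distl => /andP[? ?] /andP[? ?] /andP[? ?].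
by apply/andP; split; lra.
Qed.

HB.instance Definition _ := isMeasure.Build _ _ _ uniform_limit
  limit0 limit_ge0 limit_sigma_additive.

Let limit_setT : uniform_limit setT = 1%E.
Proof.
congr EFin; rewrite -(cvg_lim _ (@cvg_uniform_limit setT))//.
rewrite (_ : (fun _ => _) = cst 1) ?lim_cst//.
by apply/funext => n; rewrite [mu n setT]probability_setT.
Qed.

HB.instance Definition _ :=
  Measure_isProbability.Build _ _ _ uniform_limit limit_setT.

Definition uniform_limit_probability : probability T R := uniform_limit.

End uniform_setwise_limit.

(** * Stationary distributions *)

(** A form of Fatou's lemma: each partial sum over states converges by setwise convergence, and
    stays below the whole integral against [mu n]. *)
Lemma setwise_limit_integral_le (R : realType) (p : nat)
    (mu : nat -> {measure set zvec p -> \bar R})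
    (pi : {measure set zvec p -> \bar R}) (g : zvec p -> \bar R) (l : \bar R) :
  (forall A, mu n A @[n --> \oo] --> pi A) ->
  (forall y, 0 <= g y)%E -> (forall y, g y \is a fin_num) ->
  (\int[mu n]_y g y)%E @[n --> \oo] --> l -> (\int[pi]_y g y <= l)%E.
Proof.
move=> mupi g0 gfin intl; rewrite integral_zvec_series//.
have term0 (m : {measure set zvec p -> \bar R}) k :
    (0 <= g (zdecode p k) * m (@zcode p @^-1` [set k]))%E by exact: mule_ge0.
apply: lime_le; first by apply: is_cvg_nneseries => k _ _; exact: term0.
apply: nearW => N.
have cvgN : (\sum_(0 <= k < N) g (zdecode p k) * mu n (@zcode p @^-1` [set k]))%E
    @[n --> \oo] -->
    (\sum_(0 <= k < N) g (zdecode p k) * pi (@zcode p @^-1` [set k]))%E.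
  apply: cvg_nnesum => [k _|k _]; first by apply: nearW => n; exact: term0.
  by apply: cvgeZl => //; exact: mupi.
apply: lee_cvg_to cvgN intl _; apply: nearW => n.
rewrite integral_zvec_series//.
by apply: nneseries_lim_ge => k _ _; exact: term0.
Qed.

Section gw_stationary.
Context (R : realType) (p : nat) (d : measure_display) (W : measurableType d).
Context (P : probability W R).
Context (xi : 'I_p -> nat -> nat -> {RV P >-> zvec p}).
Context (eta : nat -> {RV P >-> zvec p}).
Context (X : nat -> {RV P >-> zvec p}).
Hypothesis gwX : gw_process xi eta X.

(* The limit is only shown to satisfy the inequality [<=] in the stationarity
   equation; taking complements turns it into an equality. *)
Lemma stationary_of_cvg (x : zvec p) (pi : probability (zvec p) R) :
  (forall B, gw_law xi eta x n B @[n --> \oo] --> pi B) -> stationary xi eta pi.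
Proof.
move=> cvgpi.
have le1 B : (\int[pi]_y gw_prob xi eta y 1 B <= pi B)%E.
  apply: (setwise_limit_integral_le (mu := gw_law xi eta x)) => //.
    by move=> y; exact: fin_num_gw_prob.
  rewrite (_ : (fun _ => _) = (fun n => gw_law xi eta x n.+1 B)).
    by move: (cvgpi B); rewrite -cvg_shiftS.
  by apply/funext => n; rewrite (gw_law_last_step gwX).
move=> B; apply/eqP; rewrite eq_le le1 andbT.
have probC y : (gw_prob xi eta y 1 B + gw_prob xi eta y 1 (~` B) = 1)%E.
  have -> : (gw_prob xi eta y 1 (~` B) = 1 - gw_prob xi eta y 1 B)%E.
    exact: (@probability_setC _ _ _ (gw_law xi eta y 1)).
  by rewrite addeC subeK// fin_num_gw_prob.
have intC : (\int[pi]_y gw_prob xi eta y 1 B +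
             \int[pi]_y gw_prob xi eta y 1 (~` B) = 1)%E.
  rewrite -ge0_integralD//; under eq_integral do rewrite probC.
  exact: probability_integral_cst.
have int_fin C : (\int[pi]_y gw_prob xi eta y 1 C)%E \is a fin_num.
  rewrite ge0_fin_numE; last exact: integral_ge0.
  by apply: le_lt_trans (le1 C) _; rewrite -ge0_fin_numE// fin_num_measure.
have := le1 (~` B); rewrite [pi (~` B)]probability_setC//.
move: intC; rewrite -[in X in X -> _](fineK (int_fin B)).
rewrite -(fineK (int_fin (~` B))) -(fineK (fin_num_measure pi B _))//.
rewrite -(fineK (int_fin B)) /= -EFinD -EFinB => -[].
by rewrite !lee_fin => ? ?; lra.
Qed.

Lemma stationary_iter (pi : probability (zvec p) R) n B :
  stationary xi eta pi -> (\int[pi]_x gw_prob xi eta x n B = pi B)%E.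
Proof.
move=> statpi; elim: n => [|n ih].
  transitivity (\int[pi]_x (\1_B x)%:E)%E; last by rewrite integral_indic// setIT.
  apply: eq_integral => x _; transitivity (\int[gw_law xi eta x 0]_y (\1_B y)%:E)%E.
    by rewrite integral_indic// setIT.
  by rewrite gw_law0// => y; rewrite lee_fin.
rewrite -[RHS]ih; under eq_integral do rewrite (gw_prob_first_step gwX).
symmetry; rewrite (integral_zvec_bind (mu := pi) (k := gw_law xi eta ^~ 1%N))//.
apply: eq_integral => x _; rewrite ge0_integral_distribution//.
Qed.
End gw_stationary.

(** * Geometric ergodicity: existence, uniqueness and rate *)

Local Open Scope ereal_scope.

Theorem corollary5 (R : realType) (p : nat) (d : measure_display)
    (W : measurableType d) (P : probability W R)
    (xi : 'I_p -> nat -> nat -> {RV P >-> zvec p})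
    (eta : nat -> {RV P >-> zvec p})
    (X : nat -> {RV P >-> zvec p}) (alpha : R) :
  (0 < p)%N ->
  gw_process xi eta X ->
  offspring_integrable xi ->
  (spectral_radius (mean_matrix xi) < 1)%R ->
  (0 < alpha)%R ->
  'E_P[fun w => (l1norm R (eta 0%N w) `^ alpha)%R] < +oo ->
  exists pi : probability (zvec p) R,
    [/\ stationary xi eta pi,
        (forall pi' : probability (zvec p) R, stationary xi eta pi' ->
           forall B : set (zvec p), pi' B = pi B)
      & exists a1 : R, (1 < a1)%R /\
          forall x : zvec p,
            \sum_(0 <= n <oo) (a1 ^+ n)%:E *
              ereal_sup [set `|gw_prob xi eta x n B - pi B|
                        | B in [set: set (zvec p)]] < +oo ].
Proof.
move=> _ gwX xi_int rhoM alpha0 eta_int.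
have M_ge0 i j : (0 <= mean_matrix xi i j)%R.
  rewrite mxE fine_ge0// unlock; apply: integral_ge0 => w _.
  by rewrite lee_fin.
have [rho [v [rho01 v1 Mv]]] := perron_weight M_ge0 rhoM.
have [K etaK] := innovation_weight v1 alpha0 eta_int.
set b := Num.min alpha 1%R in etaK.
have b01 : (0 < b <= 1)%R by rewrite lt_min alpha0 ltr01 ge_min lexx orbT.
pose r := (rho `^ b)%R.
have /andP[rho0 rho1] := rho01; have /andP[b0 b1] := b01.
have r0 : (0 < r)%R by rewrite powR_gt0.
have r1 : (r < 1)%R.
  have := @gt0_ltr_powR R b b0 rho 1%R; rewrite powR1; apply => //.
    by rewrite nnegrE (ltW rho0).
  by rewrite nnegrE.
have K0 : (0 <= K)%R.
  rewrite -lee_fin; apply: le_trans etaK; apply: integral_ge0 => w _.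
  by rewrite lee_fin powR_ge0.
have incr n B := gw_prob_increment gwX rho01 v1 xi_int Mv n B b01 etaK.
have r01 : (0 <= r < 1)%R by rewrite (ltW r0) r1.
pose K' := (K / (1 - r))%R.
(* The limits are chosen separately for each [B], but with the same rate for all [B], which is what
   makes [nu] a measure. *)
have [nu nuP] := choice (fun B =>
  geometric_increments_limit r01 K0 (fun n => incr n B)).
have geo0 (c : R) : (r ^+ n * c)%R @[n --> \oo] --> (0 : R)%R.
  have := @cvg_geometric R c r; rewrite gtr0_norm// => /(_ r1).
  by under eq_fun do rewrite /geometric/= mulrC.
have mu_nu n A : (`|fine (gw_law xi eta 0%R n A) - nu A| <= r ^+ n * K')%R.
  exact: nuP.
pose pi := uniform_limit_probability (geo0 K') mu_nu.
have piE B : pi B = (nu B)%:E by [].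
have bound x n B : (`|gw_prob xi eta x n B - pi B| <=
    (r ^+ n * (weight v x `^ b + K'))%:E).
  (* Triangle inequality through the chain started at [0]. *)
  have [le1 le2] := gw_prob_origin_powR gwX rho01 v1 xi_int Mv n B x b01.
  move: le1 le2; have := nuP B n; rewrite piE.
  rewrite -(fineK (fin_num_gw_prob xi eta x n B)).
  rewrite -(fineK (fin_num_gw_prob xi eta 0%R n B)) /= -!EFinD !lee_fin.
  rewrite -/r -/K' !ler_norml => /andP[? ?] ? ?; apply/andP; split; lra.
have cvg_pi x B : gw_prob xi eta x n B @[n --> \oo] --> pi B.
  rewrite piE; apply: cvg_EFin; first by apply: nearW => n; exact: fin_num_gw_prob.
  apply: cvg_dist_le (geo0 (weight v x `^ b + K')%R) _ => n /=.
  have := bound x n B; rewrite piE -(fineK (fin_num_gw_prob xi eta x n B)).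
  by rewrite lee_fin.
exists pi; split.
- by apply: (stationary_of_cvg gwX (x := 0%R)) => B; exact: cvg_pi.
- move=> pi' statpi' B.
  (* Under [pi'] the mean of [gw_prob xi eta x n B] equals [pi' B] for every [n], while it tends to
     [pi B] by dominated convergence, as the chain converges from every starting state. *)
  have : \int[pi']_x gw_prob xi eta x n B @[n --> \oo] --> \int[pi']_x pi B.
    apply: (@dominated_cvg _ _ _ _ _ _ _ _ (cst 1)) => //.
    + exact: finite_measure_integrable_cst.
    + by move=> n x _; rewrite gee0_abs//; exact: gw_prob_le1.
  rewrite probability_integral_cst.
  under eq_fun do rewrite (stationary_iter gwX _ _ statpi').
  by move/cvg_lim => /(_ (@ereal_hausdorff _)) <-; rewrite lim_cst.
(* As [r < 1], this constant is above [1] while its product [q] with [r] stays below [1]; the series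
   is then dominated by a geometric one of ratio [q]. *)
exists (2 / (1 + r))%R; split.
  by rewrite ltr_pdivlMr; lra.
move=> x; set C := (weight v x `^ b + K')%R.
have C0 : (0 <= C)%R.
  by rewrite addr_ge0 ?powR_ge0// divr_ge0// subr_ge0 ltW.
pose q := (2 / (1 + r) * r)%R.
have q0 : (0 < q)%R by rewrite mulr_gt0// divr_gt0//; lra.
have q1 : (q < 1)%R by rewrite /q mulrAC ltr_pdivrMr; lra.
apply: (@le_lt_trans _ _ (C / (1 - q))%:E); last exact: ltry.
apply: lime_le.
  apply: is_cvg_nneseries => n _ _; rewrite mule_ge0//.
    by rewrite lee_fin exprn_ge0// divr_ge0//; lra.
  (* The supremum is nonnegative because it dominates its term at the empty set. *)
  apply: le_trans (abse_ge0 (gw_prob xi eta x n set0 - pi set0)) _.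
  by apply: ereal_sup_ubound; exists set0.
apply: nearW => N.
have := geometric_le_lim N C0 q0; rewrite gtr0_norm// => /(_ q1).
rewrite -lee_fin; apply: le_trans; rewrite /series /= -sumEFin.
apply: lee_sum => n _; rewrite /geometric/=.
have -> : (C * q ^+ n = (2 / (1 + r)) ^+ n * (r ^+ n * C))%R.
  by rewrite exprMn mulrC mulrA.
rewrite [leRHS]EFinM lee_wpmul2l ?lee_fin ?exprn_ge0 ?divr_ge0//; first by lra.
by apply: ge_ereal_sup => _ [B _ <-]; exact: bound.
Qed.
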